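(* Suppose that $\theta\in(0,\pi)$ has a rational cosine, $\cos\theta=s/r$ with $r,s\in\mathbb{Z}$, $0\le |s|<r$ and $\gcd(r,s)=1$, and that $(a_0,b_0,c_0)$ and $(a_1,b_1,c_1)$ are two distinct rational $\theta$-triples for a $\theta$-congruent number $N$. Put $t_i=a_i(a_i+c_i)$ for $i=0,1$ and $$T=4r^2N^2+t_0t_1+a_0a_1\,(t_0+t_1-4sN).$$ Then the $\theta$-triple $(a_2,b_2,c_2)$ given by $$a_2=\frac{4r^2N^2+t_0t_1+a_0a_1\,(t_0+t_1-4sN)}{(a_0-a_1)(t_0-t_1)},\qquad b_2=\frac{2rN}{a_2},$$ $$c_2=\frac{(a_0-a_1)^4(t_0-2sN)^2(t_1-2sN)^2+(r^2-s^2)(t_0-t_1)^2N^2}{(a_0-a_1)(t_0-t_1)(t_0-2sN)(t_1-2sN)\,T}$$ is another rational $\theta$-triple for $N$. In particular, $(|a_2|,|b_2|,|c_2|)$ is a rational $\theta$-triangle for $N$.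
   Context: Fix $\theta\in(0,\pi)$ with $\cos\theta=s/r$, $r,s\in\mathbb{Z}$, $0\le|s|<r$, $\gcd(r,s)=1$. For a positive integer $N$, a rational $\theta$-triple for $N$ is a triple $(a,b,c)$ of rational numbers (not necessarily positive) with $a^2+b^2-\frac{2s}{r}ab=c^2$ and $ab=2rN$. The $\theta$-triples $(a,b,c)$ and $(b,a,c)$ are identified, since these equations are symmetric in $a$ and $b$. A rational $\theta$-triangle for $N$ is a rational $\theta$-triple for $N$ with $a,b,c>0$. A positive integer $N$ is a $\theta$-congruent number if there exists a rational $\theta$-triangle for $N$ (equivalently, a triangle with rational sides $a,b,c$, angle $\theta$ between the sides $a$ and $b$, and area $N\sqrt{r^2-s^2}$).
   Formalization: The printed formulas fail: in T and the numerator of a_2, +t_0t_1 is corrected to -t_0t_1, and in c_2 (t_0-t_1)^2N^2 to (t_0-t_1)^4N^2. Assumed: a_0≠a_1, t_0≠t_1, T≠0, so the quotients are defined. ''Another'' means different from both as ordered triples (a swap can occur). *)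

(* Defs.v *)
From HB Require Import structures.
From mathcomp Require Import all_boot all_order all_algebra.
From mathcomp Require Import reals trigo.
Set Implicit Arguments.
Unset Strict Implicit.
Unset Printing Implicit Defensive.
Import Order.TTheory GRing.Theory Num.Theory.
Local Open Scope ring_scope.

(* The angle theta enters only through its cosine s / r. *)
Definition theta_triple (r s : int) (N : nat) (a b c : rat) : Prop :=
  a ^+ 2 + b ^+ 2 - (2 * s%:Q / r%:Q) * a * b = c ^+ 2 /\
  a * b = 2 * r%:Q * N%:R.

Definition theta_triangle (r s : int) (N : nat) (a b c : rat) : Prop :=
  theta_triple r s N a b c /\ [/\ 0 < a, 0 < b & 0 < c].

Definition theta_congruent (r s : int) (N : nat) : Prop :=
  (0 < N)%N /\ exists a b c : rat, theta_triangle r s N a b c.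

(* Triples are identified under exchange of their first two entries. *)
Definition same_triple (x y : rat * rat * rat) : Prop :=
  x = y \/ x = (y.1.2, y.1.1, y.2).

(* Main.v *)
Require Import Defs.
From HB Require Import structures.
From mathcomp Require Import all_boot all_order all_algebra.
From mathcomp Require Import reals trigo.
From mathcomp Require Import ring lra.
Set Implicit Arguments.
Unset Strict Implicit.
Unset Printing Implicit Defensive.
Import Order.TTheory GRing.Theory Num.Theory.
Local Open Scope ring_scope.

(** The formulas for [(a2, b2, c2)] are the chord construction on an elliptic
    curve.  Put [m = s N] and [q = 4 (r^2 - s^2) N^2].  Eliminating [b] from
    the two equations of a triple gives
    [(a c)^2 = a^4 - 4 m a^2 + 4 r^2 N^2], and in terms of
    [u = a (a + c) - 2 m] this quartic becomes [2 a^2 u = u^2 + 4 m u - q],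
    that is, [(u, y)] with [y = a u] lies on the cubic
    [2 y^2 = u^3 + 4 m u^2 - q u] (lemma [theta_triple_cubic]).  Conversely a
    point with [a] and [u] nonzero gives back a triple, with [b = 2 r N / a] and
    [c = (u + q / u) / (2 a)] (lemma [cubic_theta_triple]).

    The line [y = l u + v] through the two points [(u0, a0 u0)] and
    [(u1, a1 u1)] has [v = - u0 u1 (a0 - a1) / (u0 - u1)] and meets the cubic
    again at some [u2].  The product of the three roots of
    [2 (l u + v)^2 = u^3 + 4 m u^2 - q u] is [2 v^2], so
    [u2 = 2 u0 u1 (a0 - a1)^2 / (u0 - u1)^2]; the sum of the two points, which
    is the reflection of the third one, has
    [a2 = - (l + v / u2) = (u0 - u1) / (2 (a0 - a1)) - l]
    (lemma [chord_on_cubic]).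
    Modulo the two curve equations this is the stated quotient
    (lemma [chord_numerator]), and the stated [c2] is [(u2 + q / u2) / (2 a2)].

    The sum differs from both summands: if it were [(u0, a0 u0)], the third
    point of the chord would lie above [u0], hence be [(u0, a0 u0)] itself, so
    this point would equal its reflection and [a0 = 0], against
    [a0 b0 = 2 r N > 0] (lemma [chord_neq_first]); the other summand is
    symmetric.  Finally, the absolute values form a triangle because
    [a2 b2 = 2 r N > 0] and because the numerator of [c2] is a square plus a
    positive multiple of [r^2 - s^2 > 0]. *)

(** * The chord on the cubic *)

Section ChordOnCubic.

Variable F : realFieldType.
Implicit Types m q a u : F.

(** In the coordinates [u] and [y = a u] this is the cubic
    [2 y^2 = u^3 + 4 m u^2 - q u] away from its point [u = 0]; the slope
    [a = y / u] replaces [y] because it is the first side of the triple. *)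
Definition on_cubic m q a u : Prop := 2 * a ^+ 2 * u = u ^+ 2 + 4 * m * u - q.

(** The slope [y / u] of the sum of two points, with
    [(a0 * u0 - a1 * u1) / (u0 - u1)] the slope of the chord. *)
Definition chord_a a0 u0 a1 u1 : F :=
  (u0 - u1) / (2 * (a0 - a1)) - (a0 * u0 - a1 * u1) / (u0 - u1).

Definition chord_u a0 u0 a1 u1 : F :=
  2 * u0 * u1 * (a0 - a1) ^+ 2 / (u0 - u1) ^+ 2.

Lemma chord_aC a0 u0 a1 u1 : chord_a a1 u1 a0 u0 = chord_a a0 u0 a1 u1.
Proof.
by rewrite /chord_a -(opprB u0) -(opprB a0) -(opprB (a0 * u0)) mulrN !invrN
  !mulrNN.
Qed.

Lemma chord_uC a0 u0 a1 u1 : chord_u a1 u1 a0 u0 = chord_u a0 u0 a1 u1.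
Proof.
by rewrite /chord_u -(opprB u0) -(opprB a0) !sqrrN -!mulrA (mulrCA u1).
Qed.

(** The two curve equations are linear in [m] and [q], and independent since
    [u0 != u1]; solving for [m] and [q] leaves an identity of rational
    functions in [a0, u0, a1, u1]. *)
Lemma chord_on_cubic m q a0 u0 a1 u1 :
    on_cubic m q a0 u0 -> on_cubic m q a1 u1 -> a0 != a1 -> u0 != u1 ->
  on_cubic m q (chord_a a0 u0 a1 u1) (chord_u a0 u0 a1 u1).
Proof.
rewrite /on_cubic /chord_a /chord_u => E0 E1; rewrite -subr_eq0 => a01.
rewrite -subr_eq0 => u01.
have q_eq : q = u0 ^+ 2 + 4 * m * u0 - 2 * a0 ^+ 2 * u0 by rewrite E0; ring.
have m_eq : m = (2 * (a0 ^+ 2 * u0 - a1 ^+ 2 * u1) - (u0 ^+ 2 - u1 ^+ 2))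
                / (4 * (u0 - u1)).
  apply: (canRL (mulfK _)); first by rewrite mulf_neq0 // pnatr_eq0.
  have -> : 2 * (a0 ^+ 2 * u0 - a1 ^+ 2 * u1)
          = 2 * a0 ^+ 2 * u0 - 2 * a1 ^+ 2 * u1 by ring.
  by rewrite E0 E1; ring.
rewrite q_eq m_eq; field.
by rewrite a01 u01.
Qed.

(** The left-hand side is [T] written with [t_i = u_i + 2 m] and
    [4 r^2 N^2 = q + 4 m^2]; replacing [q] by the mean of its values from the
    two curve equations removes [m] as well. *)
Lemma chord_numerator m q a0 u0 a1 u1 :
    on_cubic m q a0 u0 -> on_cubic m q a1 u1 -> a0 != a1 -> u0 != u1 ->
  q - u0 * u1 - 2 * m * (u0 + u1) + a0 * a1 * (u0 + u1)
  = chord_a a0 u0 a1 u1 * ((a0 - a1) * (u0 - u1)).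
Proof.
rewrite /on_cubic /chord_a => E0 E1; rewrite -subr_eq0 => a01.
rewrite -subr_eq0 => u01.
have -> : q = (u0 ^+ 2 + u1 ^+ 2) / 2 + 2 * m * (u0 + u1)
              - a0 ^+ 2 * u0 - a1 ^+ 2 * u1 by lra.
by field; rewrite a01 u01.
Qed.

(** If the sum had the same [u] as the first summand, then so would the third
    point of the chord; both lie on the same line, so the sum is the
    reflection of the first summand. *)
Lemma chord_same_u a0 u0 a1 u1 :
    u0 != 0 -> a0 != a1 -> u0 != u1 ->
    chord_u a0 u0 a1 u1 = u0 -> chord_a a0 u0 a1 u1 = - a0.
Proof.
rewrite /chord_u /chord_a => u0_neq0; rewrite -subr_eq0 => a01.
rewrite -subr_eq0 => u01 u_eq.
have E : (u0 - u1) ^+ 2 = 2 * u1 * (a0 - a1) ^+ 2.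
  apply: (mulfI u0_neq0); rewrite -{1}u_eq divfK ?expf_neq0 //.
  by ring.
have -> : (u0 - u1) / (2 * (a0 - a1)) = u1 * (a0 - a1) / (u0 - u1).
  apply/eqP; rewrite eqr_div ?mulf_neq0 ?pnatr_eq0 //; apply/eqP.
  by rewrite -expr2 E; ring.
by field.
Qed.

End ChordOnCubic.

(** * Triples as points of the cubic *)

Section TriplesAsPoints.

Variables (r s : int) (N : nat).
Hypotheses (s_lt_r : `|s| < r) (N_gt0 : (0 < N)%N).

Let n : rat := N%:R.
Let m : rat := s%:Q * n.
Let q : rat := 4 * (r%:Q ^+ 2 - s%:Q ^+ 2) * n ^+ 2.

Let r_gt0 : 0 < r%:Q.
Proof. by rewrite ltr0z (le_lt_trans _ s_lt_r). Qed.

Let n_gt0 : 0 < n.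
Proof. by rewrite ltr0n. Qed.

Lemma sqr_lt_of_normz_lt : s%:Q ^+ 2 < r%:Q ^+ 2.
Proof.
by rewrite -real_normK ?num_real // ltrXn2r // -intr_norm ltr_int.
Qed.

Lemma cubic_q_gt0 : 0 < q.
Proof. by rewrite !mulr_gt0 ?exprn_gt0 // subr_gt0 sqr_lt_of_normz_lt. Qed.

Lemma theta_tripleE a b c :
  theta_triple r s N a b c <->
  a * b = 2 * r%:Q * n /\ a ^+ 2 + b ^+ 2 - 4 * m = c ^+ 2.
Proof.
rewrite /theta_triple.
have cross : a * b = 2 * r%:Q * n ->
    2 * s%:Q / r%:Q * a * b = 4 * m.
  by rewrite -[_ * a * b]mulrA => ->; rewrite /m; field; rewrite gt_eqF.
by split=> [[cE abE]|[abE cE]]; split=> //; rewrite -cE cross.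
Qed.

Lemma theta_triple_a_neq0 a b c : theta_triple r s N a b c -> a != 0.
Proof.
case=> _ abE; apply/eqP => a_eq0; move/esym/eqP: abE.
by rewrite a_eq0 mul0r !mulf_eq0 pnatr_eq0 (gt_eqF r_gt0) (gt_eqF n_gt0).
Qed.

(** The equation for [c], multiplied by [a^2] to eliminate [b]. *)
Lemma theta_triple_cubic a b c :
  theta_triple r s N a b c -> on_cubic m q a (a * (a + c) - 2 * m).
Proof.
move=> /theta_tripleE[abE cE].
have acE : (a * c) ^+ 2
    = a ^+ 4 + (2 * r%:Q * n) ^+ 2 - 4 * m * a ^+ 2.
  by rewrite exprMn -cE -abE; ring.
apply/eqP; rewrite /on_cubic -subr_eq0; apply/eqP.
transitivity (a ^+ 4 + (2 * r%:Q * n) ^+ 2 - 4 * m * a ^+ 2 - (a * c) ^+ 2).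
  by rewrite /q /m; ring.
by rewrite acE subrr.
Qed.

Lemma on_cubic_u_neq0 a u : on_cubic m q a u -> u != 0.
Proof.
rewrite /on_cubic => E; apply/eqP => u_eq0; move/eqP: E.
rewrite u_eq0 mulr0 expr0n mulr0 addr0 sub0r eq_sym oppr_eq0.
by rewrite (gt_eqF cubic_q_gt0).
Qed.

(** The value of [c] comes from [a c = u + 2 m - a^2] and the expression
    [a^2 = (u + 4 m - q / u) / 2] given by the cubic. *)
Lemma cubic_theta_triple a u : a != 0 -> on_cubic m q a u ->
  theta_triple r s N a (2 * r%:Q * n / a) ((u + q / u) / (2 * a)).
Proof.
move=> a_neq0 aE; have u_neq0 := on_cubic_u_neq0 aE.
have a2E : a ^+ 2 = (u + 4 * m - q / u) / 2.
  apply: (mulIf u_neq0); apply: (mulfI (_ : 2 != 0)) => //.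
  by rewrite mulrA aE; field.
apply/theta_tripleE; split; first by field.
apply: (mulIf (_ : a ^+ 2 != 0)); first by rewrite expf_neq0.
transitivity (a ^+ 2 * a ^+ 2 + (2 * r%:Q * n) ^+ 2 - 4 * m * a ^+ 2).
  by field.
transitivity ((u + q / u) ^+ 2 / 4); last by field; rewrite a_neq0.
by rewrite a2E /q /m; field.
Qed.

Lemma cubic_u_of_theta_triple a u : a != 0 -> on_cubic m q a u ->
  a * (a + (u + q / u) / (2 * a)) - 2 * m = u.
Proof.
move=> a_neq0 aE; have u_neq0 := on_cubic_u_neq0 aE.
have qE : q = u ^+ 2 + 4 * m * u - 2 * a ^+ 2 * u by rewrite aE; ring.
by rewrite qE; field; rewrite a_neq0.
Qed.

(** Reflecting [(u, y)] to [(u, - y)] fixes only points with [a = 0], and no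
    triple has [a = 0]. *)
Lemma chord_neq_first a0 b0 c0 u0 a1 u1 b :
    theta_triple r s N a0 b0 c0 -> u0 = a0 * (a0 + c0) - 2 * m ->
    on_cubic m q a1 u1 -> a0 != a1 -> u0 != u1 ->
    chord_a a0 u0 a1 u1 != 0 ->
  (chord_a a0 u0 a1 u1, b,
   (chord_u a0 u0 a1 u1 + q / chord_u a0 u0 a1 u1)
   / (2 * chord_a a0 u0 a1 u1)) <> (a0, b0, c0).
Proof.
move=> tr0 u0E E1 a01 u01; have E0 := theta_triple_cubic tr0.
rewrite -u0E in E0; have E2 := chord_on_cubic E0 E1 a01 u01.
move=> a2_neq0 [aE _ cE]; have := cubic_u_of_theta_triple a2_neq0 E2.
rewrite cE aE -u0E => /esym uE.
have := chord_same_u (on_cubic_u_neq0 E0) a01 u01 uE.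
rewrite aE => /eqP; rewrite -addr_eq0 -mulr2n mulrn_eq0 /=.
by rewrite (negbTE (theta_triple_a_neq0 tr0)).
Qed.

Lemma theta_triangle_norm a b c : c != 0 ->
  theta_triple r s N a b c -> theta_triangle r s N `|a| `|b| `|c|.
Proof.
move=> c_neq0 /theta_tripleE[abE cE].
have ab_gt0 : 0 < a * b by rewrite abE !mulr_gt0.
have := lt0r_neq0 ab_gt0; rewrite mulf_eq0 => /norP[a_neq0 b_neq0].
split; last by rewrite !normr_gt0.
apply/theta_tripleE; split; first by rewrite -normrM gtr0_norm.
by rewrite !real_normK ?num_real.
Qed.

End TriplesAsPoints.

(** * The sum of two triples *)

Theorem theorem4p2 (R : realType) (theta : R) (r s : int) (N : nat)
    (a0 b0 c0 a1 b1 c1 : rat)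
    (theta_gt0 : 0 < theta) (theta_lt_pi : theta < pi)
    (cos_theta : cos theta = s%:~R / r%:~R)
    (s_lt_r : `|s| < r) (coprime_rs : coprimez r s)
    (N_congruent : theta_congruent r s N)
    (triple0 : theta_triple r s N a0 b0 c0)
    (triple1 : theta_triple r s N a1 b1 c1)
    (distinct01 : ~ same_triple (a0, b0, c0) (a1, b1, c1)) :
  let n : rat := N%:R in
  let r' : rat := r%:Q in
  let s' : rat := s%:Q in
  let t0 := a0 * (a0 + c0) in
  let t1 := a1 * (a1 + c1) in
  let T := 4 * r' ^+ 2 * n ^+ 2 - t0 * t1
           + a0 * a1 * (t0 + t1 - 4 * s' * n) in
  let a2 := T / ((a0 - a1) * (t0 - t1)) in
  let b2 := 2 * r' * n / a2 in
  let c2 := ((a0 - a1) ^+ 4 * (t0 - 2 * s' * n) ^+ 2 * (t1 - 2 * s' * n) ^+ 2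
             + (r' ^+ 2 - s' ^+ 2) * (t0 - t1) ^+ 4 * n ^+ 2)
            / ((a0 - a1) * (t0 - t1) * (t0 - 2 * s' * n) * (t1 - 2 * s' * n)
               * T) in
  a0 != a1 -> t0 != t1 -> T != 0 ->
  [/\ theta_triple r s N a2 b2 c2,
      (a2, b2, c2) <> (a0, b0, c0),
      (a2, b2, c2) <> (a1, b1, c1) &
      theta_triangle r s N `|a2| `|b2| `|c2|].
Proof.
move=> n r' s' t0 t1 T a2 b2 c2 a01 t01 T_neq0.
have [N_gt0 _] := N_congruent.
pose m := s' * n; pose q := 4 * (r' ^+ 2 - s' ^+ 2) * n ^+ 2.
pose u0 := t0 - 2 * m; pose u1 := t1 - 2 * m.
have E0 : on_cubic m q a0 u0 := theta_triple_cubic s_lt_r triple0.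
have E1 : on_cubic m q a1 u1 := theta_triple_cubic s_lt_r triple1.
have u01 : u0 != u1 by apply: contra t01 => /eqP/addIr ->.
have u01E : u0 - u1 = t0 - t1 by rewrite /u0 /u1; ring.
have u0_neq0 : u0 != 0 := on_cubic_u_neq0 s_lt_r N_gt0 E0.
have u1_neq0 : u1 != 0 := on_cubic_u_neq0 s_lt_r N_gt0 E1.
have da_neq0 : a0 - a1 != 0 by rewrite subr_eq0.
have dt_neq0 : t0 - t1 != 0 by rewrite subr_eq0.
have TE : T = chord_a a0 u0 a1 u1 * ((a0 - a1) * (t0 - t1)).
  by rewrite -u01E -(chord_numerator E0 E1 a01 u01) /T /q /u0 /u1 /m; ring.
have a2E : a2 = chord_a a0 u0 a1 u1 by rewrite /a2 TE mulfK // mulf_neq0.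
have a2_neq0 : a2 != 0 by rewrite /a2 mulf_neq0 ?invr_neq0 ?mulf_neq0.
set u2 := chord_u a0 u0 a1 u1.
have c2E : c2 = (u2 + q / u2) / (2 * a2).
  rewrite /c2 TE -a2E /u2 /chord_u u01E -!(mulrA 2 s' n) -/m -/u0 -/u1 /q.
  by field; rewrite ?a2_neq0 ?u0_neq0 ?u1_neq0 ?da_neq0 ?dt_neq0.
have E2 : on_cubic m q a2 u2 by rewrite a2E; apply: chord_on_cubic.
have triple2 : theta_triple r s N a2 b2 c2.
  by rewrite c2E; apply: cubic_theta_triple.
split=> //.
- rewrite c2E a2E; apply: chord_neq_first => //.
  by rewrite -a2E.
- rewrite c2E /u2 a2E -chord_aC -chord_uC; apply: chord_neq_first => //.
  + by rewrite eq_sym.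
  + by rewrite eq_sym.
  + by rewrite chord_aC -a2E.
apply: theta_triangle_norm => //.
rewrite /c2 mulf_neq0 ?invr_neq0 //; last first.
  by rewrite -!(mulrA 2 s' n) -/m -/u0 -/u1 !mulf_neq0.
apply: lt0r_neq0; apply: ltr_wpDl.
  by apply: mulr_ge0; [apply: mulr_ge0|]; rewrite exprn_even_ge0.
apply: mulr_gt0; [apply: mulr_gt0|].
- by rewrite subr_gt0 sqr_lt_of_normz_lt.
- by rewrite exprn_even_gt0.
- by rewrite exprn_gt0 // ltr0n.
Qed.
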